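(* Let $G$ and $H$ be nontrivial, connected graphs such that the direct product $G \times H$ is well-covered. If $G$ has no isolatable vertices, then $G$ is a complete graph.
   Context: All graphs are finite and simple; nontrivial means having at least two vertices. The direct product $G\times H$ has vertex set $V(G)\times V(H)$, with $(g_1,h_1)(g_2,h_2)$ an edge iff $g_1g_2\in E(G)$ and $h_1h_2\in E(H)$. A graph is well-covered if all of its maximal (with respect to inclusion) independent sets have the same cardinality. A vertex $x$ of $G$ is isolatable if there exists an independent set $I$ of $G$ such that $x$ is an isolated vertex of $G-N[I]$ (here $N[I]$ is the closed neighborhood of $I$, and $I$ may be empty). *)

(* Defs.v *)
From mathcomp Require Import all_boot.

Set Implicit Arguments.
Unset Strict Implicit.
Unset Printing Implicit Defensive.

(* A finite simple graph is an edge relation [e : rel T] on a finite vertex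
   type [T] that is symmetric and irreflexive. *)

Definition simple_graph (T : finType) (e : rel T) : Prop :=
  symmetric e /\ irreflexive e.

Definition nontrivial_graph (T : finType) : Prop := 1 < #|T|.

(* Connectedness of nonempty graphs: with no vertex this holds vacuously. *)
Definition connected_graph (T : finType) (e : rel T) : Prop :=
  forall x y : T, connect e x y.

Definition complete_graph (T : finType) (e : rel T) : Prop :=
  forall x y : T, x != y -> e x y.

Definition direct_product (S T : finType) (e : rel S) (f : rel T) :
    rel (S * T)%type :=
  [rel u v | e u.1 v.1 && f u.2 v.2].

Definition independent (T : finType) (e : rel T) (A : {set T}) : bool :=
  [forall x in A, forall y in A, ~~ e x y].

Definition well_covered (T : finType) (e : rel T) : Prop :=
  forall A B : {set T},
    maxset (independent e) A -> maxset (independent e) B -> #|A| = #|B|.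

Definition closed_nbhd (T : finType) (e : rel T) (A : {set T}) : {set T} :=
  A :|: [set y | [exists x in A, e x y]].

(* [x] is an isolated vertex of the subgraph induced by [A]. *)
Definition isolated_in (T : finType) (e : rel T) (A : {set T}) (x : T) : bool :=
  (x \in A) && [forall y in A, ~~ e x y].

Definition isolatable (T : finType) (e : rel T) (x : T) : Prop :=
  exists2 I : {set T}, independent e I & isolated_in e (~: closed_nbhd e I) x.

(* Main.v *)
Require Import Defs.
From mathcomp Require Import all_boot.

(** Fix a maximal independent set [K] of [H].  For [J] independent in [G], the
    set [J x V(H)] together with [(V(G) - N[J]) x K] is independent, and it is
    maximal because [G - N[J]] has no isolated vertex.  Comparing with the case
    of the empty [J] gives [|J| |V(H)| = |K| |N[J]|] for every independent [J].
    Taking [J] to be [{x}], [{y}] and [{x, y}] shows that nonadjacent vertices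
    [x] and [y] have disjoint closed neighbourhoods, so [G] has no induced path
    on three vertices; being connected, it is complete. *)

Section Independent.
Set Implicit Arguments.
Unset Strict Implicit.

Variables (T : finType) (e : rel T).

Lemma independentP (A : {set T}) :
  reflect {in A &, forall x y, ~~ e x y} (independent e A).
Proof.
apply: (iffP forall_inP) => indA x; last first.
  by move=> Ax; apply/forall_inP => y; apply: indA.
by move=> y Ax; move: y; apply/forall_inP/indA.
Qed.

Lemma maxset_independentI (A : {set T}) :
    independent e A -> (forall x, x \notin A -> exists2 y, y \in A & e x y) ->
  maxset (independent e) A.
Proof.
move=> indA domA; apply/maxsetP; split=> // B /independentP indB sAB.
apply/eqP; rewrite eqEsubset sAB andbT; apply/subsetP => x Bx.
apply: contraT => /domA[y Ay exy].
by have := indB x y Bx (subsetP sAB y Ay); rewrite exy.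
Qed.

(** If [x] had no neighbour in [A], then [x |: A] would be a larger independent set. *)
Lemma maxset_independent_dominates (A : {set T}) (x : T) :
    simple_graph e -> maxset (independent e) A -> x \notin A ->
  exists2 y, y \in A & e x y.
Proof.
move=> [sym_e irr_e] /maxsetP[/independentP indA maxA] nAx.
apply/exists_inP; apply: contraNT nAx => /exists_inPn nxA.
rewrite -(maxA (x |: A)) ?setU11 ?subsetUr //; apply/independentP => y z.
rewrite !in_setU1 => /predU1P[->|Ay] /predU1P[->|Az]; last exact: indA.
- by rewrite irr_e.
- exact: nxA.
- by rewrite sym_e nxA.
Qed.

Lemma maxset_independent_exists :
  exists A : {set T}, maxset (independent e) A.
Proof.
have ind0: independent e set0 by apply/independentP => x y; rewrite inE.
by have [A maxA _] := maxset_exists ind0; exists A.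
Qed.

Lemma connected_no_isolated (x : T) :
  nontrivial_graph T -> connected_graph e -> exists y, e x y.
Proof.
move=> /card_gt1P[u [v [_ _ neq_uv]]] con_e.
have [y neq_yx]: exists y, y != x.
  by case: (eqVneq u x) neq_uv => [->|]; [exists v; rewrite eq_sym | exists u].
case/connectP: (con_e x y) neq_yx => [[|z p] /= xp ->]; first by rewrite eqxx.
by case/andP: xp; exists z.
Qed.

(** Induction on a path from [x] to [y], for all endpoints. Its second vertex [z] is [y] itself or,
    by induction, adjacent to [y]; in the latter case [x], [z], [y] would induce a path unless [x]
    and [y] are adjacent. *)
Lemma connected_no_induced_P3_complete :
    simple_graph e -> connected_graph e ->
    (forall x y z, x != y -> ~~ e x y -> e x z -> ~~ e y z) ->
  complete_graph e.
Proof.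
move=> [sym_e _] con_e noP3 x y.
case/connectP: (con_e x y) => p; elim: p => [|z p IHp] in x y *.
  by move=> _ ->; rewrite eqxx.
move=> /= /andP[exz zp] Dy neq_xy; apply: contraT => nexy.
have := noP3 x y z neq_xy nexy exz.
have [Dz|neq_zy] := eqVneq z y; first by rewrite -Dz exz in nexy.
by rewrite sym_e IHp.
Qed.

Lemma in_closed_nbhd (J : {set T}) (x : T) :
  (x \in closed_nbhd e J) = (x \in J) || [exists y in J, e y x].
Proof. by rewrite !inE. Qed.

Lemma closed_nbhd0 : closed_nbhd e set0 = set0.
Proof.
apply/setP => x; rewrite in_closed_nbhd !in_set0 /=.
by apply/exists_inP => -[y]; rewrite inE.
Qed.

Lemma closed_nbhdU (A B : {set T}) :
  closed_nbhd e (A :|: B) = closed_nbhd e A :|: closed_nbhd e B.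
Proof.
apply/setP => x; rewrite in_setU !in_closed_nbhd in_setU.
have -> : [exists y in A :|: B, e y x]
        = [exists y in A, e y x] || [exists y in B, e y x].
  apply/exists_inP/orP => [[y]|].
    by rewrite in_setU => /orP[] yP eyx; [left|right]; apply/exists_inP; exists y.
  by case=> /exists_inP[y yP eyx]; exists y; rewrite // in_setU yP ?orbT.
by rewrite orbACA.
Qed.

Lemma mem_closed_nbhd1 (x z : T) : e x z -> z \in closed_nbhd e [set x].
Proof.
move=> exz; rewrite in_closed_nbhd; apply/orP; right.
by apply/exists_inP; exists x; rewrite ?set11.
Qed.

End Independent.

Section Product.
Set Implicit Arguments.
Unset Strict Implicit.

Variables (VG VH : finType) (G : rel VG) (H : rel VH).
Hypotheses (sG : simple_graph G) (sH : simple_graph H).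
Hypothesis noisoG : forall x : VG, ~ isolatable G x.
Hypothesis noisoH : forall h : VH, exists h', H h h'.

Definition layered_set (J : {set VG}) (K : {set VH}) : {set VG * VH} :=
  setX J setT :|: setX (~: closed_nbhd G J) K.

Lemma in_layered_set (J : {set VG}) (K : {set VH}) (g : VG) (h : VH) :
  ((g, h) \in layered_set J K)
    = (g \in J) || (g \notin closed_nbhd G J) && (h \in K).
Proof. by rewrite in_setU !in_setX in_setT in_setC andbT. Qed.

(** The two layers are disjoint because [J] lies in its closed neighbourhood. The additive form
    avoids truncated subtraction. *)
Lemma card_layered_set (J : {set VG}) (K : {set VH}) :
  #|layered_set J K| + #|closed_nbhd G J| * #|K| = #|J| * #|VH| + #|VG| * #|K|.
Proof.
rewrite cardsU !cardsX cardsT.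
have -> : setX J setT :&: setX (~: closed_nbhd G J) K = set0.
  apply/setP => -[g h]; rewrite in_set0 in_setI !in_setX in_setC in_closed_nbhd.
  by case: (g \in J); rewrite /= ?andbF.
by rewrite cards0 subn0 -addnA -mulnDl [#|~: _| + _]addnC cardsC.
Qed.

Lemma maxset_layered_set (J : {set VG}) (K : {set VH}) :
    independent G J -> maxset (independent H) K ->
  maxset (independent (direct_product G H)) (layered_set J K).
Proof.
have [symG irrG] := sG; move=> indJ maxK.
have /maxsetP[/independentP indK _] := maxK.
have nbJ g g' : g \in J -> g' \notin closed_nbhd G J -> ~~ G g g'.
  rewrite in_closed_nbhd negb_or => Jg /andP[_ /exists_inPn]; exact.
apply: maxset_independentI => [|[g h]].
  apply/independentP => -[g h] [g' h'].
  rewrite !in_layered_set /=.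
  (* Within a layer, independence of [J] or of [K] excludes an edge; across layers, no edge of [G]
     leaves [J] for the complement of its closed neighbourhood. *)
  case/orP=> [Jg|/andP[ng Kh]] /orP[Jg'|/andP[ng' Kh']]; rewrite negb_and /=.
  - by rewrite (independentP _ _ indJ).
  - by rewrite nbJ.
  - by rewrite symG nbJ.
  - by rewrite indK ?orbT.
rewrite in_layered_set negb_or.
have [ng|ng] /= := boolP (g \in closed_nbhd G J) => /andP[nJg].
  (* Here [g] has a neighbour in [J], whose layer is all of [VH], so any neighbour of [h] will
     do. *)
  move: ng; rewrite in_closed_nbhd (negPf nJg) => /exists_inP[g' Jg' Gg'g] _.
  have [h' Hhh'] := noisoH h; exists (g', h') => /=.
    by rewrite in_layered_set Jg'.
  by rewrite /direct_product /= symG Gg'g.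
move=> /(maxset_independent_dominates sH maxK)[h' Kh' Hhh'].
(* Without such a neighbour, [J] itself would witness that [g] is isolatable. *)
have /exists_inP[g' ng' Ggg']: [exists g' in ~: closed_nbhd G J, G g g'].
  apply: contraT => /exists_inPn isog; case: (@noisoG g); exists J => //.
  by rewrite /isolated_in in_setC ng; apply/forall_inP.
exists (g', h'); last by rewrite /direct_product /= Ggg'.
by rewrite in_layered_set -in_setC ng' Kh' orbT.
Qed.

Lemma well_covered_card_closed_nbhd (J : {set VG}) (K : {set VH}) :
    well_covered (direct_product G H) ->
    independent G J -> maxset (independent H) K ->
  #|closed_nbhd G J| * #|K| = #|J| * #|VH|.
Proof.
move=> wcGH indJ maxK.
have ind0: independent G set0 by apply/independentP => x y; rewrite inE.
have := card_layered_set set0 K; rewrite closed_nbhd0 !cards0 !mul0n addn0 => c0.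
have := card_layered_set J K.
rewrite (wcGH _ _ (maxset_layered_set indJ maxK)
                  (maxset_layered_set ind0 maxK)) c0 add0n.
by rewrite addnC => /addIn.
Qed.

Lemma well_covered_disjoint_closed_nbhd (K : {set VH}) (x y : VG) :
    well_covered (direct_product G H) ->
    maxset (independent H) K -> 0 < #|K| -> x != y -> ~~ G x y ->
  [disjoint closed_nbhd G [set x] & closed_nbhd G [set y]].
Proof.
move=> wcGH maxK K_gt0 neq_xy nGxy; have [symG irrG] := sG.
have ind1 z : independent G [set z].
  by apply/independentP => u v /set1P-> /set1P->; rewrite irrG.
have ind2: independent G ([set x] :|: [set y]).
  by apply/independentP => u v /set2P[]-> /set2P[]->; rewrite ?irrG // symG.
have card_nbhd J indJ := @well_covered_card_closed_nbhd J K wcGH indJ maxK.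
(* Disjointness is the equality case of the union bound. After multiplication by [#|K|], which is
   positive, both sides become twice [#|VH|]. *)
rewrite -leq_card_setU eqn_leq leq_card_setU /= -closed_nbhdU.
rewrite -(leq_pmul2r K_gt0) mulnDl !card_nbhd // !cards1 cards2 neq_xy.
by rewrite -mulnDl.
Qed.

End Product.

Theorem theorem4p4 (VG VH : finType) (G : rel VG) (H : rel VH)
    (sG : simple_graph G) (sH : simple_graph H)
    (ntG : nontrivial_graph VG) (ntH : nontrivial_graph VH)
    (cG : connected_graph G) (cH : connected_graph H)
    (wcGH : well_covered (direct_product G H))
    (noisoG : forall x : VG, ~ isolatable G x) :
  complete_graph G.
Proof.
have noisoH h := connected_no_isolated h ntH cH.
have [K maxK] := maxset_independent_exists H.
have K_gt0: 0 < #|K|.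
  have /card_gt0P[h _]: 0 < #|VH| by apply: ltnW.
  (* A vertex [h] of [H] lies in [K] or has a neighbour there. *)
  rewrite card_gt0; apply/set0Pn; have [|nKh] := boolP (h \in K); first by exists h.
  by have [k] := maxset_independent_dominates sH maxK nKh; exists k.
apply: connected_no_induced_P3_complete => // x y z neq_xy nGxy Gxz.
have dis := well_covered_disjoint_closed_nbhd
  sG sH noisoG noisoH wcGH maxK K_gt0 neq_xy nGxy.
(* A common neighbour [z] would lie in both closed neighbourhoods. *)
apply/negP => /mem_closed_nbhd1.
by rewrite (disjointFr dis) // mem_closed_nbhd1.
Qed.
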